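(* Let $K$ be an arbitrary field, let $h(t,z)\in K\langle t,z\rangle$, and suppose that $\deg_t h(t,z)>0$. Then the polynomial $$f(x,y,z)=x+zh(xz-zy,z)$$ is a $z$-wild coordinate of $K\langle x,y,z\rangle$.
   Context: $K\langle t,z\rangle$ and $K\langle x,y,z\rangle$ are the free associative (unital) $K$-algebras freely generated by the indicated variables. A $z$-automorphism is a $K$-algebra automorphism $\varphi$ of $K\langle x,y,z\rangle$ with $\varphi(z)=z$; it is written $\varphi=(f,g)$ with $f=\varphi(x)$, $g=\varphi(y)$. The $z$-affine automorphisms are those of the form $(\alpha_{11}x+\alpha_{21}y+\alpha_{31}z+\beta_1,\ \alpha_{12}x+\alpha_{22}y+\alpha_{32}z+\beta_2)$ with $\alpha_{ij},\beta_j\in K$ and the $2\times 2$ matrix $(\alpha_{ij})_{i,j=1,2}$ invertible. The $z$-triangular automorphisms are those of the form $(\alpha_1x+p_1(y,z),\ \alpha_2y+p_2(z))$ with $\alpha_1,\alpha_2\in K^{\ast}=K\setminus\{0\}$, $p_1\in K\langle y,z\rangle$, $p_2\in K[z]$. A $z$-automorphism is $z$-tame if it belongs to the group generated by the $z$-affine and the $z$-triangular automorphisms (under composition). A $z$-coordinate is a polynomial of the form $\varphi(x)$ for some $z$-automorphism $\varphi$; it is a $z$-tame coordinate if $\varphi$ can be chosen $z$-tame. A $z$-wild coordinate is a $z$-coordinate which is not a $z$-tame coordinate. *)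

(* Defs.v *)
From HB Require Import structures.
From mathcomp Require Import all_boot all_order all_algebra.
From mathcomp Require Import finmap.
From mathcomp Require Export monalg.

Set Implicit Arguments.
Unset Strict Implicit.
Unset Printing Implicit Defensive.

Import GRing.Theory.
Local Open Scope ring_scope.

(* The free associative unital K-algebra on n generators, as the monoid
   algebra of the free monoid on 'I_n. *)
Notation freealg K n := {malg K[{fmonom 'I_n}]}.

Definition fvar {K : fieldType} {n : nat} (i : 'I_n) : freealg K n :=
  << fmu i >>.

(* g(v_0, ..., v_(n-1)); the product over the word m is taken from left to
   right. *)
Definition feval {K : fieldType} {n : nat} {S : lalgType K}
    (v : n.-tuple S) (g : freealg K n) : S :=
  mmap (in_alg S) (fun m : {fmonom 'I_n} => \prod_(i <- m) tnth v i) g.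

(* The degree of g in the i-th variable; it is 0 for g = 0. *)
Definition deg_in {K : fieldType} {n : nat} (i : 'I_n) (g : freealg K n) : nat :=
  (\max_(m <- msupp g) count_mem i (m : seq 'I_n))%N.

(* K<t, z> *)
Notation freealg_tz K := (freealg K 2).
Definition t_index : 'I_2 := @Ordinal 2 0 isT.

(* K<x, y, z> *)
Notation freealg_xyz K := (freealg K 3).
Definition xvar {K : fieldType} : freealg_xyz K := fvar (@Ordinal 3 0 isT).
Definition yvar {K : fieldType} : freealg_xyz K := fvar (@Ordinal 3 1 isT).
Definition zvar {K : fieldType} : freealg_xyz K := fvar (@Ordinal 3 2 isT).

Notation endo K := {lrmorphism freealg_xyz K -> freealg_xyz K}.

Definition zaut {K : fieldType} (phi : endo K) : Prop :=
  bijective phi /\ phi zvar = zvar.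

Definition zaffine {K : fieldType} (phi : endo K) : Prop :=
  zaut phi /\
  exists (a : 'M[K]_2) (a3 b : 'rV[K]_2),
    [/\ a \in unitmx,
        phi xvar = a 0 0 *: xvar + a 1 0 *: yvar + a3 0 0 *: zvar + (b 0 0)%:A
      & phi yvar = a 0 1 *: xvar + a 1 1 *: yvar + a3 0 1 *: zvar + (b 0 1)%:A].

Definition ztriangular {K : fieldType} (phi : endo K) : Prop :=
  zaut phi /\
  exists (a1 a2 : K) (p1 : freealg K 2) (p2 : {poly K}),
    [/\ a1 != 0, a2 != 0,
        phi xvar = a1 *: xvar + feval [tuple yvar; zvar] p1
      & phi yvar = a2 *: yvar + (map_poly (in_alg (freealg_xyz K)) p2).[zvar]].

(* The group generated by the z-affine and the z-triangular automorphisms.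
   Endomorphisms are compared pointwise, so that membership does not depend on
   the morphism structure attached to a function. *)
Inductive ztame {K : fieldType} : endo K -> Prop :=
| ztame_affine (phi : endo K) : zaffine phi -> ztame phi
| ztame_triangular (phi : endo K) : ztriangular phi -> ztame phi
| ztame_id (phi : endo K) : phi =1 id -> ztame phi
| ztame_comp (phi psi chi : endo K) :
    ztame phi -> ztame psi -> chi =1 phi \o psi -> ztame chi
| ztame_inv (phi psi : endo K) :
    ztame phi -> cancel phi psi -> cancel psi phi -> ztame psi.

Definition zcoordinate {K : fieldType} (f : freealg_xyz K) : Prop :=
  exists2 phi : endo K, zaut phi & phi xvar = f.

Definition ztame_coordinate {K : fieldType} (f : freealg_xyz K) : Prop :=
  exists phi : endo K, [/\ zaut phi, ztame phi & phi xvar = f].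

Definition zwild_coordinate {K : fieldType} (f : freealg_xyz K) : Prop :=
  zcoordinate f /\ ~ ztame_coordinate f.

(* Main.v *)
Require Import Defs.
From HB Require Import structures.
From mathcomp Require Import all_boot all_order all_algebra finmap monalg.
From mathcomp Require Import perm zify ring.
From Stdlib Require Import Classical.

Set Implicit Arguments.
Unset Strict Implicit.
Unset Printing Implicit Defensive.

Import GRing.Theory.
Local Open Scope ring_scope.

(** Put w = xz - zy. The map x |-> x + z h(w,z), y |-> y + h(w,z) z fixes w and
    z, so replacing h by -h inverts it; hence f is a z-coordinate.

    For wildness, order words by their degree in {x, y}, then by their degree in
    z, then lexicographically for some ranking of the letters with y < x. A tame
    pair is, up to an affine change, obtained from a pair of affine elements by
    alternately swapping the components and replacing f by a f + p(g,z), where p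
    is not of the form c t + q(z). Each such p(g,z) has a larger leading word,
    namely the word obtained from a word of p by substituting the leading word
    of g for t. So the leading word of a non-affine tame coordinate only involves
    z and one letter v, the leading letter of some a x + b y, and v is the same
    for all the rankings. But the leading word of x + z h(w,z) is built from z
    and the leading word of w, which is zy if z is ranked above x and xz if z is
    ranked below x: this forces both v = y and v = x. *)

(** * Words and their orders *)

Notation lx := (@Ordinal 3 0 isT).
Notation ly := (@Ordinal 3 1 isT).
Notation lz := (@Ordinal 3 2 isT).

Section Words.
Implicit Types (s t u v : seq 'I_3) (r : 'S_3).
Local Open Scope nat_scope.

Definition xydeg s := count (fun i => i != lz) s.
Definition zdeg s := count_mem lz s.

(** The ranking of the letters does not enter here, so bounds stated with [cle] and [clt] hold for
    all rankings at once. *)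
Definition cle s t :=
  (xydeg s < xydeg t) || (xydeg s == xydeg t) && (zdeg s <= zdeg t).
Definition clt s t :=
  (xydeg s < xydeg t) || (xydeg s == xydeg t) && (zdeg s < zdeg t).

(* The word read as a number in base 3, its letters being ranked by [r]; on
   words of equal length this compares lexicographically. *)
Fixpoint wval r s : nat :=
  if s is i :: s' then r i * 3 ^ size s' + wval r s' else 0.

(** The ranking only decides between words of equal degrees, hence of equal length, where [wval] is
    lexicographic. *)
Definition wle r s t :=
  clt s t || [&& xydeg s == xydeg t, zdeg s == zdeg t & wval r s <= wval r t].

Lemma xydeg_cat s t : xydeg (s ++ t) = xydeg s + xydeg t.
Proof. exact: count_cat. Qed.

Lemma zdeg_cat s t : zdeg (s ++ t) = zdeg s + zdeg t.
Proof. exact: count_cat. Qed.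

Lemma size_deg s : size s = xydeg s + zdeg s.
Proof. by rewrite -(count_predC (pred1 lz)) addnC. Qed.

Lemma xydeg0P s : (xydeg s == 0) = all (pred1 lz) s.
Proof. by elim: s => //= i s; case: (i == lz). Qed.

Lemma wval_cat r s t : wval r (s ++ t) = wval r s * 3 ^ size t + wval r t.
Proof. by elim: s => //= i s ->; rewrite size_cat expnD mulnDl -mulnA addnA. Qed.

Lemma wval_lt r s : wval r s < 3 ^ size s.
Proof.
elim: s => //= i s IHs; have ri := ltn_ord (r i); rewrite expnS.
move: (3 ^ size s) IHs => q IHs; nia.
Qed.

(** Base 3 expansions with a given number of digits are unique, and [r] is injective on letters. *)
Lemma wval_inj r s t : size s = size t -> wval r s = wval r t -> s = t.
Proof.
elim: s t => [|i s IHs] [|j t] //= [Est].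
have := wval_lt r s; have := wval_lt r t; rewrite -Est.
move: (3 ^ _) => q lt_t lt_s E.
have Eij : r i = r j by apply: val_inj => /=; nia.
by rewrite (perm_inj Eij) (IHs t) // ; move: E; rewrite Eij => /addnI.
Qed.

Lemma wle_refl r s : wle r s s.
Proof. by rewrite /wle !eqxx leqnn orbT. Qed.

Lemma wle_trans r : transitive (wle r).
Proof. move=> t s u; rewrite /wle /clt; lia. Qed.

Lemma wle_total r : total (wle r).
Proof. move=> s t; rewrite /wle /clt; lia. Qed.

Lemma wle_anti r s t : wle r s t -> wle r t s -> s = t.
Proof.
move=> le_st le_ts; apply: (@wval_inj r).
  by rewrite !size_deg; move: le_st le_ts; rewrite /wle /clt; lia.
by move: le_st le_ts; rewrite /wle /clt; lia.
Qed.

Lemma wle_cat r s t u v : wle r s u -> wle r t v -> wle r (s ++ t) (u ++ v).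
Proof.
rewrite /wle /clt !xydeg_cat !zdeg_cat !wval_cat => le_su le_tv.
(* If the lengths differ, then [t] and [v] differ in degree, which settles the comparison; otherwise
   both values get the same weight [3 ^ size v]. *)
have [Et|] := eqVneq (size t) (size v); last by rewrite !size_deg; lia.
rewrite Et; have : 0 < 3 ^ size v by rewrite expn_gt0.
move: (3 ^ _) => q q_gt0; case/orP: le_su; first by lia.
case/andP=> /eqP-> /andP[/eqP-> le_su]; case/orP: le_tv; first by lia.
case/andP=> /eqP-> /andP[/eqP-> le_tv]; rewrite !eqxx.
by rewrite leq_add ?leq_mul ?orbT.
Qed.

(** Degrees add up, so equal products force equal degrees in each factor, and both words are cut at
    the same place. This is what excludes cancellation of leading terms in a product. *)
Lemma wle_cat_eq r s t u v :
  wle r s u -> wle r t v -> s ++ t = u ++ v -> s = u /\ t = v.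
Proof.
move=> le_su le_tv E; have Es : size s = size u.
  have := congr1 xydeg E; have := congr1 zdeg E.
  rewrite !size_deg !xydeg_cat !zdeg_cat; move: le_su le_tv.
  by rewrite /wle /clt; lia.
by move/eqP: E; rewrite eqseq_cat // => /andP[/eqP-> /eqP->].
Qed.

Lemma wle_cle r s t : wle r s t -> cle s t.
Proof. rewrite /wle /clt /cle; lia. Qed.

Lemma clt_wle r s t : clt s t -> wle r s t.
Proof. by rewrite /wle => ->. Qed.

Lemma clt_cle s t : clt s t -> cle s t.
Proof. rewrite /clt /cle; lia. Qed.

Lemma cle_lt_trans s t u : cle s t -> clt t u -> clt s u.
Proof. rewrite /clt /cle; lia. Qed.

Lemma clt_le_trans s t u : clt s t -> cle t u -> clt s u.
Proof. rewrite /clt /cle; lia. Qed.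

Lemma clt_irr s : clt s s = false.
Proof. rewrite /clt; lia. Qed.

(** * Substitution of a word for t *)

Definition wsubst u (s : seq 'I_2) : seq 'I_3 :=
  flatten [seq if i == t_index then u else [:: lz] | i <- s].

Lemma wsubst_cons u i (s : seq 'I_2) :
  wsubst u (i :: s) = (if i == t_index then u else [:: lz]) ++ wsubst u s.
Proof. by []. Qed.

Lemma xydeg_wsubst u (s : seq 'I_2) :
  xydeg (wsubst u s) = count_mem t_index s * xydeg u.
Proof.
elim: s => //= i s IHs; rewrite wsubst_cons xydeg_cat IHs mulnDl.
by case: eqP => //= _; rewrite mul1n.
Qed.

Lemma zdeg_wsubst u (s : seq 'I_2) :
  zdeg (wsubst u s) =
  count_mem t_index s * zdeg u + (size s - count_mem t_index s).
Proof.
elim: s => //= i s IHs; rewrite wsubst_cons zdeg_cat IHs mulnDl.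
have := count_size (pred1 t_index) s; case: eqP => //= _; rewrite ?mul1n; lia.
Qed.

(** Here [find] counts the z's at the head of a word; before its first copy of [u], the substituted
    word only has further z's. *)
Lemma find_wsubst u (s : seq 'I_2) : 0 < xydeg u -> t_index \in s ->
  find (fun i => i != lz) u <= find (fun i => i != lz) (wsubst u s).
Proof.
rewrite -has_count => u_xy; elim: s => //= i s IHs; rewrite wsubst_cons inE eq_sym.
case: eqP => [_ _|_ /= /IHs ?]; first by rewrite find_cat u_xy.
by rewrite (leq_trans _ (leqnSn _)).
Qed.

(** The words [u] and z generate a free monoid: the first factor of a product can be read off, then
    induction applies. *)
Lemma wsubst_inj u : 0 < xydeg u -> injective (wsubst u).
Proof.
move=> u_xy.
have no_overlap (s s' : seq 'I_2) : u ++ wsubst u s <> lz :: wsubst u s'.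
  (* The left side starts with exactly as many z's as [u], the right side with at least one more. *)
  move=> E; have Ef := congr1 (find (fun i => i != lz)) E.
  move: Ef; rewrite find_cat has_count u_xy /= => Ef.
  have: t_index \in s'.
    have := congr1 xydeg E; rewrite xydeg_cat -cat1s xydeg_cat !xydeg_wsubst.
    by rewrite -has_pred1 has_count /= add0n; case: (count_mem _ s') => //; lia.
  by move/(find_wsubst u_xy); rewrite Ef ltnn.
elim=> [|i s IHs] [|j s'] //.
- rewrite wsubst_cons => /(congr1 size); rewrite size_cat /=.
  by case: eqP => //= _; rewrite size_deg; lia.
- rewrite wsubst_cons => /(congr1 size); rewrite size_cat /=.
  by case: eqP => //= _; rewrite size_deg; lia.
rewrite !wsubst_cons.
have I2 (k : 'I_2) : k != t_index -> k = @Ordinal 2 1 isT.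
  by case: k => [[|[|k]] lt_k2] //= _; apply: val_inj.
case: eqP => [->|/eqP/I2->]; case: eqP => [->|/eqP/I2->] E.
- by move/eqP: E; rewrite eqseq_cat // eqxx /= => /eqP/IHs->.
- by case: (no_overlap _ _ E).
- by case: (no_overlap _ _ (esym E)).
- by case: E => /IHs->.
Qed.

(** These are the words that cannot occur in c t + q(z). *)
Definition nontrivial (s : seq 'I_2) := (t_index \in s) && (s != [:: t_index]).

Lemma clt_wsubst u (s : seq 'I_2) : 0 < xydeg u -> nontrivial s -> clt u (wsubst u s).
Proof.
move=> u_xy /andP[s_t s_nt]; rewrite /clt xydeg_wsubst zdeg_wsubst.
have c_gt0: 0 < count_mem t_index s by rewrite -has_count has_pred1.
have := count_size (pred1 t_index) s => le_c.
(* Two or more letters t raise the degree in {x, y}; a single t comes with some z, which raises the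
   degree in z. *)
have [c1|c_neq1] := eqVneq (count_mem t_index s) 1; last by nia.
suff: size s != 1 by rewrite c1 in le_c *;
  rewrite !mul1n ltnn eqxx -ltn_subLR // subnn subn_gt0 ltn_neqAle le_c eq_sym => ->.
apply: contra s_nt => /eqP; case: s s_t {c_gt0 le_c c1} => [|i [|]] //=.
by rewrite inE eq_sym => /eqP->.
Qed.

Lemma all_wsubst (P : pred 'I_3) u (s : seq 'I_2) :
  P lz -> all P u -> all P (wsubst u s).
Proof.
move=> Pz Pu; elim: s => //= i s IHs; rewrite wsubst_cons all_cat IHs andbT.
by case: eqP => //= _; rewrite Pz.
Qed.

End Words.

(** * Evaluation and leading words *)

Lemma malg_scalerAr (K : fieldType) n (c : K) (f g : freealg K n) :
  c *: (f * g) = f * (c *: g).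
Proof.
apply/malgP=> m; rewrite [LHS]mcoeffZ.
rewrite [RHS](mcoeffMlw m (fsubset_refl _) (msuppZ_le c g)).
rewrite mcoeffMl mulr_sumr; apply: eq_bigr => i _; rewrite mulr_sumr.
by apply: eq_bigr => j _; rewrite (mcoeffZ c g j) mulrnAr mulrCA.
Qed.

Section Eval.
Variables (K : fieldType) (n k : nat).
Implicit Types (g : freealg K n).

Lemma malgU_mul (m1 m2 : {fmonom 'I_n}) :
  << m1 >> * << m2 >> = << mmul m1 m2 >> :> freealg K n.
Proof. by rewrite malgM_def fgmulUU mulr1. Qed.

Lemma prod_fvar (m : {fmonom 'I_n}) :
  \prod_(i <- m) fvar i = << m >> :> freealg K n.
Proof.
case: m => s /=; elim: s => [|i s IHs].
  by rewrite big_nil; congr << _ >>; apply/eqP; rewrite fmP fm1.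
rewrite big_cons IHs malgU_mul; congr << _ >>; apply/eqP.
by rewrite fmP fmM fmU.
Qed.

Lemma fevalE (S : lalgType K) (v : n.-tuple S) g :
  feval v g = \sum_(m <- msupp g) g@_m *: \prod_(i <- m) tnth v i.
Proof. by apply: eq_bigr => m _; rewrite mulr_algl. Qed.

Lemma fevalZU (S : lalgType K) (v : n.-tuple S) c (m : {fmonom 'I_n}) :
  feval v << c *g m >> = c *: \prod_(i <- m) tnth v i.
Proof. by rewrite /feval mmapU mulr_algl. Qed.

Lemma fevalU (S : lalgType K) (v : n.-tuple S) (m : {fmonom 'I_n}) :
  feval v << m >> = \prod_(i <- m) tnth v i.
Proof. by rewrite fevalZU scale1r. Qed.

Lemma feval_fvar (S : lalgType K) (v : n.-tuple S) i :
  feval v (fvar i) = tnth v i.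
Proof. by rewrite fevalU fmU big_seq1. Qed.

Lemma malg_sum g : g = \sum_(m <- msupp g) g@_m *: << m >>.
Proof.
rewrite {1}[g]monalgE; apply: eq_bigr => m _; apply/malgP => m'.
by rewrite [LHS]mcoeffU [RHS]mcoeffZ mcoeffU1 mulr_natr.
Qed.

Lemma feval_id (v : n.-tuple (freealg K n)) g :
  (forall i, tnth v i = fvar i) -> feval v g = g.
Proof.
move=> Ev; rewrite fevalE [RHS]malg_sum; apply: eq_bigr => m _.
by rewrite -prod_fvar; congr (_ *: _); apply: eq_bigr => i _.
Qed.

Section Morphism.
Variable v : n.-tuple (freealg K k).

Fact feval_additive : additive (feval v).
Proof. exact: mmap_is_additive. Qed.

HB.instance Definition _ := GRing.isAdditive.Build _ _ (feval v) feval_additive.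

Fact feval_scalable : scalable (feval v).
Proof.
move=> c g; have [->|c_nz] := eqVneq c 0; first by rewrite !scale0r raddf0.
rewrite !fevalE msuppZ (negPf c_nz) scaler_sumr; apply: eq_bigr => m _.
by rewrite (mcoeffZ c g m) scalerA.
Qed.

HB.instance Definition _ := GRing.isScalable.Build _ _ _ _ (feval v) feval_scalable.

Fact feval_multiplicative : multiplicative (feval v).
Proof.
split=> [f g|]; last by rewrite fevalU fm1 big_nil.
rewrite malgME raddf_sum [in RHS]fevalE mulr_suml; apply: eq_bigr => i _ /=.
rewrite raddf_sum (fevalE v g) mulr_sumr; apply: eq_bigr => j _ /=.
by rewrite fevalZU fmM big_cat /= -[RHS]scalerAl -malg_scalerAr scalerA.
Qed.

HB.instance Definition _ :=
  GRing.isMultiplicative.Build _ _ (feval v) feval_multiplicative.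

End Morphism.

Lemma lrmorph_feval (S T : lalgType K) (phi : {lrmorphism S -> T})
    (v : n.-tuple S) g :
  phi (feval v g) = feval (map_tuple phi v) g.
Proof.
rewrite !fevalE raddf_sum; apply: eq_bigr => m _ /=; rewrite linearZ rmorph_prod.
by congr (_ *: _); apply: eq_bigr => i _; rewrite tnth_map.
Qed.

End Eval.

(** * Leading words of products and of substitutions *)

Section Lead.
Variable K : fieldType.
Variable r : 'S_3.
Local Notation A := (freealg_xyz K).
Local Notation word := {fmonom 'I_3}.
Implicit Types (f g : A) (u : word).

(** A relation rather than a function, so that no leading word has to be chosen for 0. *)
Definition lead f u := u \in msupp f /\ {in msupp f, forall m : word, wle r m u}.

Lemma wle_antif (m m' : word) : wle r m m' -> wle r m' m -> m = m'.
Proof. by move=> h h'; apply/eqP; rewrite fmP; apply/eqP; apply: wle_anti h h'. Qed.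

Lemma leadU u : lead << u >> u.
Proof.
by split=> [|m]; rewrite msuppU1 in_fset1 // => /eqP->; apply: wle_refl.
Qed.

Lemma leadZ c f u : c != 0 -> lead f u -> lead (c *: f) u.
Proof. by move=> c_nz; rewrite /lead msuppZ (negPf c_nz). Qed.

Lemma leadN f u : lead f u -> lead (- f) u.
Proof. by rewrite /lead msuppN. Qed.

Lemma leadDr f g u : lead g u -> {in msupp f, forall m : word, wle r m u} ->
  u \notin msupp f -> lead (f + g) u.
Proof.
move=> [gu leg] lef u_f; split=> [|m /(fsubsetP (msuppD_le _ _))].
  by rewrite -mcoeff_neq0 mcoeffD (mcoeff_outdom u_f) add0r mcoeff_neq0.
by rewrite in_fsetU => /orP[/lef|/leg].
Qed.

Lemma lead_clt f g u : lead g u -> {in msupp f, forall m : word, clt m u} ->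
  lead (f + g) u.
Proof.
move=> gu ltf; apply: leadDr => // [m /ltf/clt_wle //|].
by apply/negP => /ltf; rewrite clt_irr.
Qed.

Lemma lead_uniq f u u' : lead f u -> lead f u' -> u = u'.
Proof. by move=> [fu leu] [fu' leu']; apply: wle_antif; [apply: leu'|apply: leu]. Qed.

Lemma leadM f g u u' : lead f u -> lead g u' -> lead (f * g) (mmul u u').
Proof.
move=> [fu lef] [gu' leg]; split=> [|_ /msuppM_le[m [m' [mf m'g ->]]]]; last first.
  by rewrite !fmM wle_cat ?lef ?leg.
(* By [wle_cat_eq], only the pair [u], [u'] contributes to this coefficient, which is thus a product
   of two nonzero scalars. *)
rewrite -mcoeff_neq0 mcoeffMl (big_fsetD1 u) //= (big_fsetD1 u') //=.
rewrite eqxx mulr1n !big1_fset ?addr0 ?mulf_neq0 ?mcoeff_neq0 // => m.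
  rewrite in_fsetD1 => /andP[m_u mf] _; rewrite big1_fset // => m' m'g _.
  case: eqP => // /(congr1 (@fmonom_val _)); rewrite !fmM => E.
  have [Em _] := wle_cat_eq (lef _ mf) (leg _ m'g) E.
  by case/eqP: m_u; apply/eqP; rewrite fmP Em.
rewrite in_fsetD1 => /andP[m_u mg] _.
case: eqP => // /(congr1 (@fmonom_val _)); rewrite !fmM => E.
have [_ Em] := wle_cat_eq (lef _ fu) (leg _ mg) E.
by case/eqP: m_u; apply/eqP; rewrite fmP Em.
Qed.

Lemma seq_max (T : eqType) (F : T -> word) (s : seq T) x : x \in s ->
  exists2 y, y \in s & {in s, forall z, wle r (F z) (F y)}.
Proof.
elim: s x => // y [|y' s] IHs x _.
  by exists y => [|z]; rewrite inE // => /eqP->; apply: wle_refl.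
have [w w_s le_w] := IHs y' (mem_head _ _).
case/orP: (wle_total r (F w) (F y)) => le_wy.
  exists y => [|z]; rewrite ?mem_head // inE => /predU1P[->|/le_w le_z].
    exact: wle_refl.
  exact: wle_trans le_z le_wy.
exists w => [|z]; rewrite inE ?w_s ?orbT // => /predU1P[->//|/le_w //].
Qed.

Lemma lead_prod g u (s : seq 'I_2) : lead g u ->
  lead (\prod_(i <- s) tnth [tuple g; zvar] i) (FMonom (wsubst u s)).
Proof.
move=> gu; elim: s => [|i s IHs].
  have -> : FMonom (wsubst u [::]) = mone :> word by apply/eqP; rewrite fmP fm1.
  by rewrite big_nil; apply: leadU.
have -> : FMonom (wsubst u (i :: s)) =
    mmul (if i == t_index then u else fmu lz) (FMonom (wsubst u s)) :> word.
  apply/eqP; rewrite fmP fmM [fmonom_val (FMonom _)]/= wsubst_cons.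
  by case: ifP => // _; rewrite fmU.
rewrite big_cons; apply: leadM => //.
have [->|] := eqVneq i t_index; first by rewrite (tnth_nth 0).
by case: i => [[|[|i]] lt_i2] // _; rewrite (tnth_nth 0); apply: leadU.
Qed.

(** By injectivity of [wsubst u], distinct words of [p] give distinct leading words, so the largest
    of these survives. The word [m0] only provides a lower bound for it. *)
Lemma lead_feval g u (p : freealg K 2) (m0 : {fmonom 'I_2}) :
    lead g u -> (0 < xydeg u)%N -> m0 \in msupp p ->
  exists m : {fmonom 'I_2},
    lead (feval [tuple g; zvar] p) (FMonom (wsubst u m)) /\
    wle r (wsubst u m0) (wsubst u m).
Proof.
move=> gu u_xy m0p.
pose F (m : {fmonom 'I_2}) : word := FMonom (wsubst u m).
have Finj : injective F.
  by move=> m m' [] /(wsubst_inj u_xy) E; apply/eqP; rewrite fmP E.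
have [m mp le_m] := seq_max F m0p.
exists m; split; last exact: le_m.
split=> [|m']; last first.
  rewrite -mcoeff_neq0 fevalE raddf_sum /=; apply: contraNT => nle.
  rewrite big_seq big1 // => k kp; rewrite mcoeffZ [X in _ * X]mcoeff_outdom ?mulr0 //.
  apply: contra nle => m'k; apply: wle_trans (le_m _ kp).
  by case: (lead_prod k gu) => _; apply.
rewrite -mcoeff_neq0 fevalE raddf_sum /= (big_fsetD1 m mp) /= [X in X + _]mcoeffZ.
rewrite big1_fset ?addr0 ?mulf_neq0 ?mcoeff_neq0 //.
  by case: (lead_prod m gu).
(* If another word [k] contributed to this coefficient, its leading word would be at least that of
   [m], hence equal to it by maximality, against injectivity. *)
move=> k; rewrite in_fsetD1 => /andP[k_m kp] _.
rewrite mcoeffZ [X in _ * X]mcoeff_outdom ?mulr0 //; apply: contra k_m => mk.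
apply/eqP/Finj/wle_antif; first exact: le_m.
by case: (lead_prod k gu) => _; apply.
Qed.

End Lead.

(** * Reduced pairs *)

Lemma lin_comb (K : fieldType) (V : lmodType K) (x y p p1 p2 : V)
    (a b a1 b1 a2 b2 : K) :
  a *: (a1 *: x + b1 *: y + p1) + b *: (a2 *: x + b2 *: y + p2) + p =
  (a * a1 + b * a2) *: x + (a * b1 + b * b2) *: y + (a *: p1 + b *: p2 + p).
Proof.
rewrite !scalerDr !scalerA !scalerDl [RHS]addrA; congr (_ + p).
by rewrite [LHS]addrACA; congr (_ + _); rewrite [LHS]addrACA.
Qed.

Section Reduction.
(* [zpoly e] stands for [e \in K[z]], and [subalg g e] for [e \in K<g, z>]. *)
Variables (K : fieldType) (V : lmodType K) (x y : V).
Variables (zpoly : V -> Prop) (subalg : V -> V -> Prop).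
Hypotheses (zpoly0 : zpoly 0)
  (zpolyD : forall e f, zpoly e -> zpoly f -> zpoly (e + f))
  (zpolyZ : forall c e, zpoly e -> zpoly (c *: e)).
Hypotheses (subalgD : forall g e f, subalg g e -> subalg g f -> subalg g (e + f))
  (subalgZ : forall g c e, subalg g e -> subalg g (c *: e))
  (subalg_self : forall g, subalg g g)
  (subalg_zpoly : forall g e, zpoly e -> subalg g e)
  (subalg_trans : forall g g' e, subalg g g' -> subalg g' e -> subalg g e).
Implicit Types (e f g q r : V).

Lemma zpoly_comb a b e f q : zpoly e -> zpoly f -> zpoly q ->
  zpoly (a *: e + b *: f + q).
Proof. by move=> *; do !apply: zpolyD => //; apply: zpolyZ. Qed.

(** Adding such an [e] to the other component is an affine change and does not count as a reduction
    step. *)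
Definition ztrivial g e := exists c r, zpoly r /\ e = c *: g + r.

(** A step also swaps the components, so that consecutive steps alter different ones; two steps on
    the same component would merge into one. *)
Inductive reduced : V -> V -> Prop :=
| reduced_affine a b c d p q of a * d - b * c != 0 & zpoly p & zpoly q :
    reduced (a *: x + b *: y + p) (c *: x + d *: y + q)
| reduced_step g f a e of reduced g f & a != 0 & subalg g e & ~ ztrivial g e :
    reduced (a *: f + e) g.

(** The change is absorbed by the last step: it modifies [e] by a scalar factor and a trivial
    element, so [e] stays nontrivial. *)
Lemma reduced_comb f g c d q : reduced f g -> c != 0 -> zpoly q ->
  reduced (c *: f + d *: g + q) g.
Proof.
move=> Rfg c_nz zq.
case: Rfg => [a b a' b' p p' det_nz zp zp'|{}g {}f a e Rgf a_nz ge e_nt].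
  rewrite lin_comb; apply: reduced_affine; rewrite ?zpoly_comb //.
    have -> : (c * a + d * a') * b' - (c * b + d * b') * a' = c * (a * b' - b * a').
      by ring.
    by rewrite mulf_neq0.
  exact: zpoly_comb.
rewrite scalerDr scalerA -!addrA; apply: reduced_step; rewrite ?mulf_neq0 //.
  do !apply: subalgD;
    [exact: subalgZ | exact/subalgZ/subalg_self | exact: subalg_zpoly].
move=> [k [r [zr E]]]; case: e_nt; exists (c^-1 * (k - d)), (c^-1 *: (r - q)).
split; first by apply/zpolyZ/zpolyD => //; rewrite -scaleN1r; apply: zpolyZ.
rewrite -scalerA -scalerDr; apply: (canRL (scalerK _)) => //.
rewrite scalerBl addrACA -E -opprD; exact: (canRL (addrK _)).
Qed.

(** An affine pair is treated as a step with [e] equal to 0 from the swapped pair, so both kinds of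
    reduced pairs are handled alike. *)
Lemma reduced_peel f g : reduced f g ->
  exists f1 a e, [/\ reduced g f1, a != 0, subalg g e & f = a *: f1 + e].
Proof.
case=> [a b c d p q det_nz zp zq|{}g f1 a e Rgf a_nz ge _]; last by exists f1, a, e.
exists (a *: x + b *: y + p), 1, 0; rewrite scale1r addr0.
split; rewrite ?oner_neq0 //; last exact: subalg_zpoly.
apply: reduced_affine => //; have -> : c * b - d * a = - (a * d - b * c) by ring.
by rewrite oppr_eq0.
Qed.

(** * Affine and elementary changes of tame pairs *)

Definition tame_pair f g := exists f0 g0 a b c d p q,
  [/\ reduced f0 g0, a * d - b * c != 0, zpoly p, zpoly q &
      f = a *: f0 + b *: g0 + p /\ g = c *: f0 + d *: g0 + q].

Lemma tame_pair_id : tame_pair x y.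
Proof.
have Rxy : reduced (1 *: x + 0 *: y + 0) (0 *: x + 1 *: y + 0).
  by apply: reduced_affine => //; rewrite mulr1 mulr0 subr0 oner_neq0.
exists (1 *: x + 0 *: y + 0), (0 *: x + 1 *: y + 0), 1, 0, 0, 1, 0, 0.
split=> //; first by rewrite mulr1 mulr0 subr0 oner_neq0.
by rewrite !scale1r !scale0r !addr0 !add0r.
Qed.

Lemma tame_pair_affine f g a b c d p q : a * d - b * c != 0 ->
    zpoly p -> zpoly q -> tame_pair f g ->
  tame_pair (a *: f + b *: g + p) (c *: f + d *: g + q).
Proof.
move=> det_nz zp zq [f0 [g0 [a1 [b1 [c1 [d1 [p1 [q1 [R det1_nz zp1 zq1 [-> ->]]]]]]]]]].
rewrite !lin_comb; exists f0, g0; do 6!eexists; split; last by split; reflexivity.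
- exact: R.
- have -> : (a * a1 + b * c1) * (c * b1 + d * d1) -
      (a * b1 + b * d1) * (c * a1 + d * c1)
    = (a * d - b * c) * (a1 * d1 - b1 * c1) by ring.
  by rewrite mulf_neq0.
- exact: zpoly_comb.
exact: zpoly_comb.
Qed.

(* If [g] involves [f0], then [g, g0] is again a reduced pair; otherwise the
   last reduction step is peeled off and merged with [e]. *)
Lemma tame_pair_elem1 f g e : tame_pair f g -> subalg g e -> tame_pair (f + e) g.
Proof.
move=> [f0 [g0 [a [b [c [d [p [q [R det_nz zp zq [Ef Eg]]]]]]]]]] ge.
have [c0|c_nz] := eqVneq c 0; last first.
  have Rg : reduced g g0 by rewrite Eg; apply: reduced_comb.
  (* Eliminating [f0] between [f] and [g] leaves the coefficient [k] at [g0]; up to sign it is the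
     determinant divided by [c]. *)
  pose k := b - a / c * d; pose e2 := (a / c) *: g + (p - (a / c) *: q) + e.
  have k_nz : k != 0.
    apply: contra det_nz => /eqP k0; have -> : a * d - b * c = - (c * k).
      by rewrite /k; field.
    by rewrite k0 mulr0 oppr0.
  have Efe : f + e = k *: g0 + e2.
    rewrite /e2 /k Ef Eg !scalerDr !scalerA divfK // scalerBl.
    have cancel_XQ (F B P X Q E : V) :
        F + B + P + E = B - X + (F + X + Q + (P - Q) + E).
      rewrite -[F + X + Q + _]addrA [Q + _]addrC subrK !addrA.
      by rewrite (addrAC _ F X) subrK (addrC F B).
    exact: cancel_XQ.
  have ge2 : subalg g e2.
    do !apply: subalgD => //; [exact/subalgZ/subalg_self|exact: subalg_zpoly|].
    by rewrite -scaleNr; apply/subalgZ/subalg_zpoly.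
  (* If [e2] is trivial, the new pair is an affine change of [g, g0]; otherwise it is one step above
     [g, g0]. *)
  have [[k' [r [zr E2]]]|e2_nt] := classic (ztrivial g e2).
    exists g, g0, k', k, 1, 0, r, 0; split=> //.
    - by rewrite mulr0 mulr1 sub0r oppr_eq0.
    by rewrite scale1r scale0r !addr0 Efe E2 addrCA addrA.
  exists (k *: g0 + e2), g, 1, 0, 0, 1, 0, 0; split=> //.
  - exact: reduced_step.
  - by rewrite mulr0 mulr1 subr0 oner_neq0.
  by rewrite !scale1r !scale0r !addr0 add0r.
(* Now [g] is [d *: g0 + q], so [e] lies in the subalgebra of [g0] and combines with the last step
   on [f0]. *)
move: det_nz; rewrite c0 mulr0 subr0 mulf_eq0 negb_or => /andP[a_nz d_nz].
rewrite c0 scale0r add0r in Eg.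
have [f1 [al [e0 [Rg al_nz ge0 Ef0]]]] := reduced_peel R.
have g0e : subalg g0 e.
  apply: subalg_trans ge; rewrite Eg.
  by apply: subalgD; [exact/subalgZ/subalg_self | exact: subalg_zpoly].
pose e2 := a *: e0 + (b *: g0 + p + e).
have Efe : f + e = (a * al) *: f1 + e2.
  by rewrite /e2 Ef Ef0 scalerDr scalerA -!addrA.
have ge2 : subalg g0 e2.
  do !apply: subalgD => //;
    [exact: subalgZ | exact/subalgZ/subalg_self | exact: subalg_zpoly].
have [[k [r [zr E2]]]|e2_nt] := classic (ztrivial g0 e2).
  exists g0, f1, k, (a * al), d, 0, r, q; split=> //.
  - by rewrite mulr0 sub0r oppr_eq0 !mulf_neq0.
  by rewrite scale0r addr0 Efe E2 addrCA addrA.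
exists ((a * al) *: f1 + e2), g0, 1, 0, 0, d, 0, q; split=> //.
- by apply: reduced_step; rewrite ?mulf_neq0.
- by rewrite mul1r mulr0 subr0.
by rewrite scale1r !scale0r !addr0 add0r.
Qed.

Lemma tame_pair_elem f g a d e q : tame_pair f g -> a != 0 -> d != 0 ->
  subalg g e -> zpoly q -> tame_pair (a *: f + e) (d *: g + q).
Proof.
move=> T a_nz d_nz ge zq.
have := tame_pair_elem1 T (subalgZ a^-1 ge).
move/(@tame_pair_affine _ _ a 0 0 d 0 q); rewrite mulr0 subr0 mulf_neq0 //.
move=> /(_ isT zpoly0 zq); rewrite !scale0r addr0 add0r addr0.
by rewrite scalerDr scalerA divff // scale1r.
Qed.

Lemma tame_pair_affine_inv f g a b c d p q : a * d - b * c != 0 ->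
    zpoly p -> zpoly q ->
    tame_pair (a *: f + b *: g + p) (c *: f + d *: g + q) -> tame_pair f g.
Proof.
set D := a * d - b * c => D_nz zp zq.
(* The inverse matrix is the adjugate divided by [D]; [p'] and [q'] are the translation parts of the
   inverse affine change. *)
pose p' := - ((d / D) *: p + (- b / D) *: q).
pose q' := - ((- c / D) *: p + (a / D) *: q).
have zN e : zpoly e -> zpoly (- e) by rewrite -scaleN1r; apply: zpolyZ.
have zp' : zpoly p' by apply/zN/zpolyD; apply: zpolyZ.
have zq' : zpoly q' by apply/zN/zpolyD; apply: zpolyZ.
move/(@tame_pair_affine _ _ (d / D) (- b / D) (- c / D) (a / D) p' q').
rewrite !lin_comb !subrr !addr0.
have -> : d / D * (a / D) - - b / D * (- c / D) = D^-1 by rewrite /D; field.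
have -> : d / D * a + - b / D * c = 1 by rewrite /D; field.
have -> : d / D * b + - b / D * d = 0 by rewrite /D; field.
have -> : - c / D * a + a / D * c = 0 by rewrite /D; field.
have -> : - c / D * b + a / D * d = 1 by rewrite /D; field.
by rewrite !scale1r !scale0r add0r addr0; apply; rewrite ?invr_eq0.
Qed.

(** The inverse change is again elementary, because [g], and with it [e], lies in the subalgebra
    generated by [d *: g + q] and z. *)
Lemma tame_pair_elem_inv f g a d e q : a != 0 -> d != 0 ->
    subalg g e -> zpoly q -> tame_pair (a *: f + e) (d *: g + q) -> tame_pair f g.
Proof.
move=> a_nz d_nz ge zq T.
have zN c : zpoly (- (c *: q)) by rewrite -scaleNr; apply: zpolyZ.
have Eg : g = d^-1 *: (d *: g + q) - d^-1 *: q.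
  by rewrite scalerDr scalerA mulVf // scale1r addrK.
have gg : subalg (d *: g + q) g.
  by rewrite {2}Eg; apply: subalgD; [exact/subalgZ/subalg_self | exact: subalg_zpoly].
have ge' : subalg (d *: g + q) (- (a^-1 *: e)).
  by rewrite -scaleNr; apply/subalgZ/(subalg_trans gg).
have := tame_pair_elem T (_ : a^-1 != 0) (_ : d^-1 != 0) ge' (zN d^-1).
rewrite !invr_eq0 -Eg => /(_ a_nz d_nz).
by rewrite scalerDr scalerA mulVf // scale1r addrK.
Qed.

End Reduction.

(** * The subalgebra generated by an element and z *)

Section Subalgebra.
Variable K : fieldType.
Local Notation A := (freealg_xyz K).
Local Notation word := {fmonom 'I_3}.
Implicit Types (e f g q r : A) (u : word).

(** K[z] is described through supports, the form in which leading words are compared. *)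
Definition zpoly e := {in msupp e, forall m : word, xydeg m = 0%N}.

Lemma zpoly0 : zpoly 0.
Proof. by move=> m; rewrite msupp0. Qed.

Lemma zpolyD e f : zpoly e -> zpoly f -> zpoly (e + f).
Proof.
move=> ze zf m /(fsubsetP (msuppD_le _ _)).
by rewrite in_fsetU => /orP[/ze|/zf].
Qed.

Lemma zpolyZ c e : zpoly e -> zpoly (c *: e).
Proof. by move=> ze m /(fsubsetP (msuppZ_le _ _))/ze. Qed.

Lemma zpolyM e f : zpoly e -> zpoly f -> zpoly (e * f).
Proof.
move=> ze zf _ /msuppM_le[m [m' [/ze m0 /zf m'0 ->]]].
by rewrite fmM xydeg_cat m0 m'0.
Qed.

Lemma zpoly1 : zpoly 1.
Proof. by move=> m; rewrite msuppU1 in_fset1 => /eqP->; rewrite fm1. Qed.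

Lemma zpoly_z : zpoly zvar.
Proof. by move=> m; rewrite msuppU1 in_fset1 => /eqP->; rewrite fmU. Qed.

Definition subalg g e := exists p : freealg K 2, e = feval [tuple g; zvar] p.

Lemma subalg0 g : subalg g 0.
Proof. by exists 0; rewrite raddf0. Qed.

Lemma subalgD g e f : subalg g e -> subalg g f -> subalg g (e + f).
Proof. by move=> [p ->] [p' ->]; exists (p + p'); rewrite raddfD. Qed.

Lemma subalgZ g c e : subalg g e -> subalg g (c *: e).
Proof. by move=> [p ->]; exists (c *: p); rewrite feval_scalable. Qed.

Lemma subalgM g e f : subalg g e -> subalg g f -> subalg g (e * f).
Proof.
move=> [p ->] [p' ->]; exists (p * p').
by rewrite (feval_multiplicative _).1.
Qed.

Lemma subalg1 g : subalg g 1.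
Proof. by exists 1; rewrite (feval_multiplicative _).2. Qed.

Lemma subalg_self g : subalg g g.
Proof. by exists (fvar t_index); rewrite feval_fvar (tnth_nth 0). Qed.

Lemma subalg_z g : subalg g zvar.
Proof. by exists (fvar (@Ordinal 2 1 isT)); rewrite feval_fvar (tnth_nth 0). Qed.

Lemma subalg_zpoly g e : zpoly e -> subalg g e.
Proof.
move=> ze; rewrite [e]malg_sum big_seq; apply: big_ind.
- exact: subalg0.
- exact: subalgD.
move=> m /ze/eqP; rewrite xydeg0P => /allP m_z; apply: subalgZ.
rewrite -prod_fvar big_seq; apply: big_ind.
- exact: subalg1.
- exact: subalgM.
by move=> i /m_z/eqP->; apply: subalg_z.
Qed.

Lemma subalg_trans g g' e : subalg g g' -> subalg g' e -> subalg g e.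
Proof.
move=> gg' [p ->]; rewrite fevalE; apply: big_ind.
- exact: subalg0.
- exact: subalgD.
move=> m _; apply: subalgZ; apply: big_ind.
- exact: subalg1.
- exact: subalgM.
move=> [[|[|i]] lt_i2] _ //; rewrite (tnth_nth 0) //=; exact: subalg_z.
Qed.

(** If [p] had no nontrivial word, its words without t would contribute elements of K[z] and the
    word t a multiple of [g], making [e] trivial. *)
Lemma subalg_nontrivial g e : subalg g e -> ~ ztrivial zpoly g e ->
  exists p (m : {fmonom 'I_2}),
    [/\ m \in msupp p, nontrivial m & e = feval [tuple g; zvar] p].
Proof.
move=> [p ->] nt.
have [/hasP[m mp m_nt]|/hasPn p_tr] :=
    boolP (has (fun m : {fmonom 'I_2} => nontrivial m) (msupp p)).
  by exists p, m.
case: nt; rewrite fevalE big_seq; apply: big_ind.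
- by exists 0, 0; rewrite scale0r addr0; split=> //; apply: zpoly0.
- move=> _ _ [c [r [zr ->]]] [c' [r' [zr' ->]]].
  exists (c + c'), (r + r'); split; first exact: zpolyD.
  by rewrite scalerDl addrACA.
move=> m /p_tr; rewrite /nontrivial negb_and negbK => /orP[m_z|/eqP->].
  exists 0, (p@_m *: \prod_(i <- m) tnth [tuple g; zvar] i).
  rewrite scale0r add0r; split=> //; apply: zpolyZ.
  rewrite big_seq; apply: big_ind; [exact: zpoly1 | exact: zpolyM|].
  move=> i mi; suff ->: i = @Ordinal 2 1 isT.
    by rewrite (tnth_nth 0); apply: zpoly_z.
  case: i mi => [[|[|i]] lt_i2] // mi; last exact: val_inj.
  by move: m_z; rewrite (_ : t_index = Ordinal lt_i2) ?mi //; apply: val_inj.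
exists p@_m, 0; split; first exact: zpoly0.
by rewrite big_seq1 (tnth_nth 0) addr0.
Qed.

End Subalgebra.

(** * Leading words of tame coordinates *)

Lemma addr_rot (V : zmodType) (x y z : V) : x + y + z = y + z + x.
Proof. by rewrite -addrA addrC. Qed.

Section LeadReduced.
Variable K : fieldType.
Local Notation A := (freealg_xyz K).
Local Notation word := {fmonom 'I_3}.
Implicit Types (e f g q : A) (u : word).
Local Notation zpoly := (@zpoly K).
Local Notation subalg := (@subalg K).
Local Notation reduced := (reduced xvar yvar zpoly subalg).
Local Notation tame_pair := (tame_pair xvar yvar zpoly subalg).

Lemma mcoeff_affine a b p (m : word) :
  (a *: xvar + b *: yvar + p : A)@_m =
  a * (fmu lx == m)%:R + b * (fmu ly == m)%:R + p@_m.
Proof.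
rewrite [LHS]mcoeffD [X in X + _ = _]mcoeffD; congr (_ + _ + _).
  by rewrite [LHS]mcoeffZ [X in _ * X = _]mcoeffU1.
by rewrite [LHS]mcoeffZ [X in _ * X = _]mcoeffU1.
Qed.

Lemma msupp_affine a b p (m : word) : zpoly p ->
    m \in msupp (a *: xvar + b *: yvar + p) ->
  [\/ a != 0 /\ m = fmu lx, b != 0 /\ m = fmu ly | xydeg m = 0%N].
Proof.
move=> zp; have [/zp|m_p] := boolP (m \in msupp p); first by constructor 3.
rewrite -mcoeff_neq0 mcoeff_affine (mcoeff_outdom m_p) addr0.
have [->|_] := eqVneq (fmu lx) m.
  have [->|a_nz] := eqVneq a 0; last by constructor 1.
  have [->|_] := eqVneq (fmu ly) m; last by rewrite mulr0 mul0r addr0 eqxx.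
  by rewrite mul0r add0r mulr1; constructor 2.
have [->|_] := eqVneq (fmu ly) m; last by rewrite !mulr0 addr0 eqxx.
by rewrite mulr0 add0r mulr1; constructor 2.
Qed.

Lemma msupp_affine_cle a b p : zpoly p ->
  {in msupp (a *: xvar + b *: yvar + p), forall m : word, cle m [:: lx]}.
Proof.
move=> zp m /(msupp_affine zp)[[_ ->]|[_ ->]|m0]; rewrite ?fmU //.
by rewrite /cle m0.
Qed.

(* The letter [v] does not depend on the order [r]. *)
Definition lead_in v f g := forall r : 'S_3, (r ly < r lx)%N ->
  exists u : word, [/\ lead r f u, (0 < xydeg u)%N, all (pred2 v lz) u &
                    {in msupp g, forall m : word, cle m u}].

(** The strict form holds after a reduction step and lets the first component dominate in affine
    combinations. *)
Definition lead_in_lt v f g := forall r : 'S_3, (r ly < r lx)%N ->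
  exists u : word, [/\ lead r f u, (0 < xydeg u)%N, all (pred2 v lz) u &
                    {in msupp g, forall m : word, clt m u}].

Lemma lead_in_affine a b c d p q : zpoly p -> zpoly q -> a * d - b * c != 0 ->
  exists2 v, v != lz &
    lead_in v (a *: xvar + b *: yvar + p) (c *: xvar + d *: yvar + q).
Proof.
move=> zp zq det_nz.
have p_nz (i : 'I_3) : i != lz -> p@_(fmu i) = 0.
  move=> i_z; apply: mcoeff_outdom; apply/negP => /zp.
  by rewrite fmU /xydeg /= i_z.
have lyx : (fmu ly == fmu lx :> word) = false by rewrite fmP !fmU.
(* As y is ranked below x, the letter is y if the coefficient of x vanishes and x otherwise. *)
have [a0|a_nz] := eqVneq a 0.
  have b_nz : b != 0.
    by apply: contra det_nz => /eqP->; rewrite a0 !mul0r subr0.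
  exists ly => // r r_yx; exists (fmu ly); split; rewrite ?fmU //.
    split=> [|m /(msupp_affine zp)[[]|[_ ->]|m0]].
    - by rewrite -mcoeff_neq0 mcoeff_affine p_nz // a0 mul0r add0r addr0 eqxx mulr1.
    - by rewrite a0 eqxx.
    - exact: wle_refl.
    by rewrite /wle /clt m0 fmU.
  by move=> m /(msupp_affine_cle zq).
exists lx => // r r_yx; exists (fmu lx); split; rewrite ?fmU //.
  split=> [|m /(msupp_affine zp)[[_ ->]|[_ ->]|m0]].
  - rewrite -mcoeff_neq0 mcoeff_affine p_nz // eqxx mulr1 addr0.
    by rewrite lyx mulr0 addr0.
  - exact: wle_refl.
  - by rewrite !fmU /wle /= !expn0 !muln1 !addn0 ltnW // orbT.
  by rewrite /wle /clt m0 fmU.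
by move=> m /(msupp_affine_cle zq).
Qed.

(** The leading word of [e] is strictly above that of [g], which bounds the degrees of [f]; so [e]
    dominates both, and substitution brings in no letter but z. *)
Lemma lead_in_step v g f a e : lead_in v g f -> subalg g e ->
  ~ ztrivial zpoly g e -> lead_in_lt v (a *: f + e) g.
Proof.
move=> Wgf ge e_nt r r_yx; have [u [gu u_xy u_v le_f]] := Wgf r r_yx.
have [p [m0 [m0p m0_nt ->]]] := subalg_nontrivial ge e_nt.
have [m [pm le_m]] := lead_feval gu u_xy m0p.
have lt_u : clt u (wsubst u m).
  exact: clt_le_trans (clt_wsubst u_xy m0_nt) (wle_cle le_m).
exists (FMonom (wsubst u m)); split.
- apply: lead_clt => // k /(fsubsetP (msuppZ_le _ _))/le_f le_k.
  exact: cle_lt_trans lt_u.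
- by move: u_xy lt_u; rewrite /clt /=; case: (xydeg u) => //; lia.
- by rewrite all_wsubst //= eqxx orbT.
by move=> k; case: gu => _ /[apply] /wle_cle le_k; apply: cle_lt_trans lt_u.
Qed.

Lemma lead_in_ltW v f g : lead_in_lt v f g -> lead_in v f g.
Proof.
move=> W r /W[u [fu u_xy u_v lt_g]]; exists u; split=> // m /lt_g.
exact: clt_cle.
Qed.

Lemma reduced_lead f g : reduced f g -> exists2 v, v != lz & lead_in v f g.
Proof.
elim=> [a b c d p q det_nz zp zq|{}g {}f a e _ [v v_z W] a_nz ge e_nt].
  exact: lead_in_affine.
by exists v => //; apply: lead_in_ltW; apply: lead_in_step e_nt.
Qed.

Lemma tame_pair_lead f g : tame_pair f g ->
  {in msupp f, forall m : word, cle m [:: lx]} \/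
  exists2 v, v != lz & forall r : 'S_3, (r ly < r lx)%N ->
    exists2 u, lead r f u & all (pred2 v lz) u.
Proof.
move=> [f0 [g0 [a [b [c [d [p [q [R det_nz zp _ [-> _]]]]]]]]]].
case: R => [a1 b1 c1 d1 p1 q1 _ zp1 zq1|{}g {}f al e Rgf al_nz ge e_nt].
  left; rewrite (_ : _ + _ + _ = (a * a1 + b * c1) *: xvar +
    (a * b1 + b * d1) *: yvar + (a *: p1 + b *: q1 + p)); last exact: lin_comb.
  apply: msupp_affine_cle; exact: (zpoly_comb (@zpolyD K) (@zpolyZ K)).
right; have [v v_z W] := reduced_lead Rgf; exists v => // r r_yx.
(* If the coefficient of the dominant component vanishes, the leading word comes from [g]; it
   involves the same letter [v]. *)
have [a0|a_nz] := eqVneq a 0.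
  have b_nz : b != 0.
    by apply: contra det_nz => /eqP->; rewrite a0 !mul0r subr0.
  have [u [gu u_xy u_v _]] := W r r_yx; exists u => //.
  rewrite a0 scale0r add0r [X in lead _ X]addrC.
  apply: lead_clt; first exact: leadZ.
  by move=> m /zp m0; rewrite /clt m0 u_xy.
have [u [fu u_xy u_v lt_g]] := lead_in_step al W ge e_nt r_yx.
exists u => //; rewrite [X in lead _ X]addr_rot.
apply: lead_clt; first exact: leadZ.
move=> m /(fsubsetP (msuppD_le _ _)); rewrite in_fsetU => /orP[|/zp m0].
  by move=> /(fsubsetP (msuppZ_le _ _))/lt_g.
by rewrite /clt m0 u_xy.
Qed.

End LeadReduced.

(** * Tame automorphisms and tame pairs *)

Lemma lrmorph_affine (K : fieldType) (S T : lalgType K)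
    (psi : {lrmorphism S -> T}) (x y z : S) (a b c d : K) :
  psi (a *: x + b *: y + c *: z + d%:A) =
  a *: psi x + b *: psi y + (c *: psi z + d *: 1).
Proof. by rewrite !raddfD /= !linearZ /= rmorph1 addrA. Qed.

Lemma lrmorphZD (K : fieldType) (S T : lalgType K)
    (psi : {lrmorphism S -> T}) (x e : S) (a : K) :
  psi (a *: x + e) = a *: psi x + psi e.
Proof. by rewrite raddfD /= linearZ. Qed.

Lemma rmorph_shear (S T : nzRingType) (psi : {rmorphism S -> T}) (x z H : S) :
  psi (x + z * H) = psi x + psi z * psi H /\
  psi (x + H * z) = psi x + psi H * psi z.
Proof. by rewrite !rmorphD !rmorphM. Qed.

(** Both products acquire the same term [z' * H * z'], which cancels. *)
Lemma shear_invariant (S T : nzRingType) (psi : {rmorphism S -> T})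
    (x y z : S) (x' y' z' H : T) :
    psi x = x' + z' * H -> psi y = y' + H * z' -> psi z = z' ->
  psi (x * z - z * y) = x' * z' - z' * y'.
Proof.
move=> Ex Ey Ez; rewrite rmorphB !rmorphM /= Ex Ey Ez mulrDl mulrDr opprD.
by rewrite addrACA -mulrA subrr addr0.
Qed.

Section Tame.
Variable K : fieldType.
Local Notation A := (freealg_xyz K).
Local Notation word := {fmonom 'I_3}.
Implicit Types (e f g q : A) (u : word) (phi psi chi : endo K).
Local Notation zpoly := (@zpoly K).
Local Notation subalg := (@subalg K).
Local Notation tame_pair := (tame_pair xvar yvar zpoly subalg).

Lemma zpoly_horner (p : {poly K}) :
  zpoly (map_poly (in_alg (freealg_xyz K)) p).[zvar].
Proof.
rewrite horner_coef; apply: big_ind; [exact: zpoly0 | exact: zpolyD |].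
move=> i _; rewrite coef_map; apply: zpolyM.
  exact/zpolyZ/zpoly1.
elim: (val i) => [|k IHk]; first exact: zpoly1.
by rewrite exprS; exact: zpolyM (@zpoly_z K) IHk.
Qed.

Lemma endo_zpoly psi e : psi zvar = zvar -> zpoly e -> psi e = e.
Proof.
move=> psi_z ze; pose v : 3.-tuple A := [tuple fvar i | i < 3].
have Ev i : tnth v i = fvar i by rewrite tnth_mktuple.
rewrite -{1}[e](feval_id _ Ev) lrmorph_feval -[RHS](feval_id _ Ev) !fevalE.
apply: eq_big_seq => m /ze/eqP; rewrite xydeg0P => /allP m_z; congr (_ *: _).
apply: eq_big_seq => i /m_z/eqP ->; rewrite tnth_map Ev; exact: psi_z.
Qed.

Lemma endo_subalg psi (p : freealg K 2) : psi zvar = zvar ->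
  psi (feval [tuple yvar; zvar] p) = feval [tuple psi yvar; zvar] p.
Proof.
move=> psi_z; rewrite lrmorph_feval; congr feval; apply: val_inj => /=.
by rewrite psi_z.
Qed.

Lemma det_mx2 (a : 'M[K]_2) : \det a = a 0 0 * a 1 1 - a 1 0 * a 0 1.
Proof.
rewrite (expand_det_row _ 0) !big_ord_recl big_ord0 addr0 /cofactor !det_mx11 !mxE /=.
rewrite expr0 mul1r expr1 mulN1r mulrN [a 1 0 * _]mulrC.
by do ![congr (_ - _) | congr (_ * _)]; congr (a _ _); apply: val_inj.
Qed.

Lemma zaffine_tame_pair phi psi : zaffine phi -> psi zvar = zvar ->
  tame_pair (psi xvar) (psi yvar) <->
  tame_pair (psi (phi xvar)) (psi (phi yvar)).
Proof.
move=> [_ [a [a3 [b [a_unit -> ->]]]]] psi_z.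
(* The coefficients of the image of x form a column of [a], hence the transposed order of the
   indices. *)
have det_nz : a 0 0 * a 1 1 - a 1 0 * a 0 1 != 0.
  by rewrite -det_mx2 -unitfE -unitmxE.
have zp c d : zpoly (c *: psi zvar + d *: 1).
  rewrite psi_z; apply: zpolyD; [exact/zpolyZ/zpoly_z|exact/zpolyZ/zpoly1].
have psiE c1 c2 c3 d : psi (c1 *: xvar + c2 *: yvar + c3 *: zvar + d%:A) =
    c1 *: psi xvar + c2 *: psi yvar + (c3 *: psi zvar + d *: 1).
  exact: lrmorph_affine.
rewrite [X in _ <-> tame_pair X _]psiE [X in _ <-> tame_pair _ X]psiE; split.
  exact: (tame_pair_affine (@zpolyD K) (@zpolyZ K)).
exact: (tame_pair_affine_inv (@zpolyD K) (@zpolyZ K)).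
Qed.

Lemma ztriangular_tame_pair phi psi : ztriangular phi -> psi zvar = zvar ->
  tame_pair (psi xvar) (psi yvar) <->
  tame_pair (psi (phi xvar)) (psi (phi yvar)).
Proof.
move=> [_ [a [d [p [q [a_nz d_nz -> ->]]]]]] psi_z.
have psiE c f e : psi (c *: f + e) = c *: psi f + psi e by exact: lrmorphZD.
rewrite [X in _ <-> tame_pair X _]psiE [X in _ <-> tame_pair _ X]psiE
  [X in _ <-> tame_pair (_ + X) _](endo_subalg _ psi_z)
  [X in _ <-> tame_pair _ (_ + X)](endo_zpoly psi_z (@zpoly_horner q)).
have sub_e : subalg (psi yvar) (feval [tuple psi yvar; zvar] p) by exists p.
have zq := @zpoly_horner q; split=> T.
  apply: (tame_pair_elem (@zpoly0 K) (@zpolyD K) (@zpolyZ K) (@subalgD K)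
    (@subalgZ K) (@subalg_self K) (@subalg_zpoly K) (@subalg_trans K)) => //.
exact: (tame_pair_elem_inv (@zpoly0 K) (@zpolyD K) (@zpolyZ K) (@subalgD K)
  (@subalgZ K) (@subalg_self K) (@subalg_zpoly K) (@subalg_trans K)
  a_nz d_nz sub_e zq T).
Qed.

(** The equivalence for every [psi] makes the induction work: a composite is handled by taking
    [psi \o phi1] for [psi], an inverse by taking [psi \o phi'] and reading the equivalence
    backwards. *)
Lemma ztame_tame_pair phi : ztame phi ->
  phi zvar = zvar /\ forall psi, psi zvar = zvar ->
    (tame_pair (psi xvar) (psi yvar) <->
     tame_pair (psi (phi xvar)) (psi (phi yvar))).
Proof.
elim=> {phi} [phi aff|phi tri|phi phi1|phi1 phi2 phi _ [z1 IH1] _ [z2 IH2] E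
             |phi phi' _ [phi_z IH] K1 K2].
- split=> [|psi]; [by case: aff => -[] | exact: zaffine_tame_pair].
- split=> [|psi]; [by case: tri => -[] | exact: ztriangular_tame_pair].
- by split=> [|psi _]; rewrite !phi1.
- split=> [|psi psi_z]; first by rewrite E /= z2.
  rewrite !E; apply: iff_trans (IH1 psi psi_z) _.
  apply: (IH2 (psi \o phi1 : endo K)) => /=; by rewrite z1.
have phi'_z : phi' zvar = zvar by rewrite -[in LHS]phi_z K1.
split=> // psi psi_z; apply: iff_sym.
have /= := IH (psi \o phi' : endo K) _; rewrite phi'_z => /(_ psi_z).
by rewrite !K1.
Qed.

End Tame.

(** * The coordinate x + z h(xz - zy, z) *)

Section Shear.
Variable K : fieldType.
Local Notation A := (freealg_xyz K).
Local Notation word := {fmonom 'I_3}.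
Local Notation w := (xvar * zvar - zvar * yvar : A).
Implicit Types (H : A) (h : freealg_tz K).

Definition shear H : endo K :=
  feval [tuple xvar + zvar * H; yvar + H * zvar; zvar].

Lemma shear_x H : shear H xvar = xvar + zvar * H.
Proof. exact: feval_fvar. Qed.

Lemma shear_y H : shear H yvar = yvar + H * zvar.
Proof. exact: feval_fvar. Qed.

Lemma shear_z H : shear H zvar = zvar.
Proof. exact: feval_fvar. Qed.

Lemma shear_inv H h :
  shear H (feval [tuple w; zvar] h) = feval [tuple w; zvar] h.
Proof.
rewrite [LHS]lrmorph_feval; congr feval; apply: val_inj => /=.
rewrite [X in [:: X; _]](shear_invariant (shear_x H) (shear_y H) (shear_z H)).
by rewrite [X in [:: _; X]]shear_z.
Qed.

(** Since [H] is a polynomial in w and z, every shear fixes it, and the two added terms cancel. *)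
Lemma shearK H H' h : H = feval [tuple w; zvar] h -> H' = - H ->
  cancel (shear H) (shear H').
Proof.
move=> EH EH' p; rewrite /shear [LHS]lrmorph_feval.
have fixH : shear H' H = H by rewrite EH shear_inv.
have Ex : shear H' (xvar + zvar * H) =
    shear H' xvar + shear H' zvar * shear H' H.
  exact: (rmorph_shear (shear H') _ _ _).1.
have Ey : shear H' (yvar + H * zvar) =
    shear H' yvar + shear H' H * shear H' zvar.
  exact: (rmorph_shear (shear H') _ _ _).2.
apply: feval_id => -[[|[|[|i]]] lt_i3] //; rewrite (tnth_nth 0) /=.
- apply: etrans Ex _; rewrite fixH shear_x shear_z EH'.
  by rewrite mulrN subrK; congr fvar; apply: val_inj.
- apply: etrans Ey _; rewrite fixH shear_y shear_z EH'.
  by rewrite mulNr subrK; congr fvar; apply: val_inj.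
- by apply: etrans (shear_z _) _; congr fvar; apply: val_inj.
Qed.

Lemma shear_zcoordinate h :
  zcoordinate (xvar + zvar * feval [tuple w; zvar] h).
Proof.
set H := feval _ h; exists (shear H); last exact: shear_x.
split; last exact: shear_z.
exists (shear (- H)); first exact: (@shearK _ _ h).
apply: (@shearK _ _ (- h)); last by rewrite opprK.
by rewrite raddfN.
Qed.

(** * Leading words of w and of the coordinate *)

Lemma leadBr r (m m' : word) : m != m' -> wle r m m' ->
  lead r (<< m >> - << m' >> : A) m'.
Proof.
move=> m_m' le_m; apply: leadDr; first exact/leadN/leadU.
  by move=> k; rewrite msuppU1 in_fset1 => /eqP->.
by rewrite msuppU1 in_fset1 eq_sym.
Qed.

Lemma leadBl r (m m' : word) : m != m' -> wle r m m' ->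
  lead r (<< m' >> - << m >> : A) m'.
Proof. by move=> m_m' /(leadBr m_m')/leadN; rewrite opprB. Qed.

Lemma w_monomials :
  w = << mmul (fmu lx) (fmu lz) >> - << mmul (fmu lz) (fmu ly) >>.
Proof. by congr (_ - _); apply: malgU_mul. Qed.

Lemma w_words_neq : mmul (fmu lx) (fmu lz) != mmul (fmu lz) (fmu ly) :> word.
Proof. by rewrite fmP !fmM !fmU. Qed.

(** The words xz and zy have the same degrees, so their first letters decide. *)
Lemma lead_w_zy (r : 'S_3) : (r lx < r lz)%N ->
  lead r w (mmul (fmu lz) (fmu ly)).
Proof.
move=> r_xz; rewrite w_monomials; apply: leadBr; first exact: w_words_neq.
rewrite !fmM !fmU /wle /= !expn0 !expn1 !muln1 !addn0.
by have := ltn_ord (r lz); lia.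
Qed.

Lemma lead_w_xz (r : 'S_3) : (r lz < r lx)%N ->
  lead r w (mmul (fmu lx) (fmu lz)).
Proof.
move=> r_zx; rewrite w_monomials; apply: leadBl; first by rewrite eq_sym w_words_neq.
rewrite !fmM !fmU /wle /= !expn0 !expn1 !muln1 !addn0.
by have := ltn_ord (r ly); lia.
Qed.

Lemma lead_shear r u h : lead r w u -> xydeg u = 1%N ->
    (0 < deg_in t_index h)%N ->
  exists U : word,
    [/\ lead r (xvar + zvar * feval [tuple w; zvar] h) U, clt [:: lx] U &
        {subset (u : seq _) <= (U : seq _)}].
Proof.
move=> wu u_xy deg_h.
have [m0 m0h m0_t] : exists2 m0 : {fmonom 'I_2},
    m0 \in msupp h & t_index \in (m0 : seq _).
  apply/hasP; apply: contraLR deg_h => /hasPn h_z.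
  rewrite -eqn0Ngt /deg_in big1_seq // => m /andP[_ /h_z m_t].
  exact/count_memPn.
have u_gt0 : (0 < xydeg u)%N by rewrite u_xy.
have [m [hm le_m]] := lead_feval wu u_gt0 m0h.
(* The dominating word [m] may differ from [m0], but its image has at least the same degree in {x,
   y}; so t occurs in [m] and all letters of [u] survive. *)
have m_xy : (0 < xydeg (wsubst u m))%N.
  have : (0 < xydeg (wsubst u m0))%N.
    by rewrite xydeg_wsubst u_xy muln1 -has_count has_pred1.
  by move: le_m; rewrite /wle /clt; lia.
have zm : clt [:: lx] (lz :: wsubst u m).
  by rewrite /clt -cat1s xydeg_cat zdeg_cat /=; lia.
exists (mmul (fmu lz) (FMonom (wsubst u m))); split.
- apply: lead_clt; first by apply: leadM => //; apply: leadU.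
  by move=> k; rewrite msuppU1 in_fset1 => /eqP->; rewrite fmM !fmU.
- by rewrite fmM fmU.
have m_t : t_index \in (m : seq _).
  by move: m_xy; rewrite xydeg_wsubst u_xy muln1 -has_count has_pred1.
move=> i iu; rewrite fmM mem_cat; apply/orP; right; apply/flattenP.
by exists (fmonom_val u) => //; apply/mapP; exists t_index.
Qed.

End Shear.

Theorem corollary2p4 (K : fieldType) (h : freealg_tz K)
    (deg_h : (0 < deg_in t_index h)%N) :
  zwild_coordinate
    (xvar + zvar * feval [tuple xvar * zvar - zvar * yvar; zvar] h).
Proof.
split; first exact: shear_zcoordinate.
move=> [phi [_ phi_tame phi_x]].
(* With the identity for [psi], the pair x, y is carried to the components of [phi]. *)
have [_ /(_ idfun erefl)[T _]] := ztame_tame_pair phi_tame.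
have := tame_pair_lead (T (tame_pair_id _ _ _ (@zpoly0 K))).
rewrite /= phi_x.
(* The rankings are y < x < z for [r1] and z < y < x for [r2]; both put y below x. *)
pose r1 : 'S_3 := tperm lx ly; pose r2 : 'S_3 := tperm lx lz.
have r1x : r1 lx = ly by apply: tpermL.
have r1y : r1 ly = lx by apply: tpermR.
have r1z : r1 lz = lz by apply: tpermD.
have r2x : r2 lx = lz by apply: tpermL.
have r2y : r2 ly = ly by apply: tpermD.
have r2z : r2 lz = lx by apply: tpermR.
have w1 : lead r1 _ _ := @lead_w_zy K r1 _.
have w2 : lead r2 _ _ := @lead_w_xz K r2 _.
rewrite r1x r1z in w1; rewrite r2x r2z in w2.
have xyE i j : xydeg (mmul (fmu i) (fmu j) : {fmonom 'I_3}) = xydeg [:: i; j].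
  by rewrite fmM !fmU.
have [U1 [f1 lt1 sub1]] := lead_shear (w1 isT) (xyE _ _) deg_h.
have [U2 [f2 _ sub2]] := lead_shear (w2 isT) (xyE _ _) deg_h.
case=> [le_f|[v v_z L]].
  (* The affine case is impossible, as the leading word exceeds x in degree. *)
  by have := cle_lt_trans (le_f _ f1.1) lt1; rewrite clt_irr.
have [|u1 /(lead_uniq f1) <- /allP v1] := L r1; first by rewrite r1x r1y.
have [|u2 /(lead_uniq f2) <- /allP v2] := L r2; first by rewrite r2x r2y.
(* The letter y occurs in the first leading word and x in the second, so [v] would equal both. *)
have := v1 ly (sub1 ly _); have := v2 lx (sub2 lx _).
rewrite !fmM !fmU => /(_ isT) /= /orP[/eqP<-|//] /(_ isT) //.
Qed.
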